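(* Consider allocating a set of $m$ indivisible items among $n$ agents with additive valuations. The $\textsc{Round-Robin}^{\text{pass}}$ mechanism is Bayesian incentive compatible for every product prior $\times_{i=1}^n\mathcal D_i$ in which each $\mathcal D_i$ is neutral. Moreover, on every report profile it outputs an allocation that is $\mathrm{SD}^+$efficient and EF1 (with respect to the reported valuations).
   Context: Items are $[m]$, agents are $[n]$. Each agent $i$ has a private valuation vector $\mathbf v_i\in\mathbb R^m_{\ge 0}$. An allocation is $\mathbf x\in\{0,1\}^{n\times m}$ with $\sum_i x_{i,j}=1$ for every $j$; $\mathbf x_i$ (or $X_i=\{j:x_{i,j}=1\}$) is agent $i$'s bundle, and $u_i(\mathbf x)=\sum_j v_{i,j}x_{i,j}$, $u_i(S)=\sum_{j\in S}v_{i,j}$. For a valuation (or report) of agent $i$, let $\mathbf p_i$ be the ranking of the items in decreasing order of value, ties broken in favor of the lower index, with $\mathbf p_i(k)$ the $k$-th ranked item; let $\mathcal M_i^+$ be the set of items with positive value and $m_i=|\mathcal M_i^+|$. $\textsc{Round-Robin}^{\text{pass}}$: given reports, compute $(\mathbf p_i,\mathcal M_i^+)$ for each agent $i$. Proceed in rounds; in each round the agents act in the fixed order $1,2,\dots,n$. On her turn, agent $i$ is allocated the best-ranked (according to $\mathbf p_i$) remaining item, except that if all items of $\mathcal M_i^+$ have already been allocated her turn is skipped. Repeat until all items are allocated or every remaining item is reported as zero-valued by all agents; in the latter case the remaining items are allocated in an arbitrary deterministic way. Neutral prior: a distribution $\mathcal D_i$ on $\mathbb R^m_{\ge0}$ such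 that for every permutation $\sigma$ of $[m]$, $\Pr_{\mathbf v_i\sim\mathcal D_i}[v_{i,\sigma(1)}>\dots>v_{i,\sigma(m)}]=1/m!$, and for each item $j$ the marginal distribution of $v_{i,j}$ has no point masses. BIC for $\times_i\mathcal D_i$: for every agent $i$, true valuation $\mathbf v_i$ and report $\mathbf b_i$, $\mathbb E_{\mathbf v_{-i}\sim\mathcal D_{-i}}[u_i(\mathbf x(\mathbf v_i,\mathbf v_{-i}))]\ge\mathbb E_{\mathbf v_{-i}\sim\mathcal D_{-i}}[u_i(\mathbf x(\mathbf b_i,\mathbf v_{-i}))]$, where $\mathcal D_{-i}=\times_{j\ne i}\mathcal D_j$ and $u_i$ is computed with $\mathbf v_i$. EF1: for every pair of agents $i,j$ with $X_j\neq\emptyset$, there is $g\in X_j$ with $u_i(X_i)\ge u_i(X_j\setminus\{g\})$. $\mathrm{SD}^+$efficiency: for bundles $\mathbf a,\mathbf b\in\{0,1\}^m$, write $\mathbf a\succeq_i^+\mathbf b$ iff $\sum_{k=1}^{\ell}a_{\mathbf p_i(k)}\ge\sum_{k=1}^{\ell}b_{\mathbf p_i(k)}$ for all $\ell\in\{1,\dots,m_i\}$, and $\mathbf a\succ_i^+\mathbf b$ iff $\mathbf a\succeq_i^+\mathbf b$ and at least one of these inequalities (for some $\ell\le m_i$) is strict. An allocation $\mathbf x$ is $\mathrm{SD}^+$efficient iff there is no allocation $\mathbf y$ with $\mathbf y_i\succeq_i^+\mathbf x_i$ for all agents $i$ and $\mathbf y_j\succ_j^+\mathbf x_j$ for some agent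 $j$. *)

(* Defs.v *)
From HB Require Import structures.
From mathcomp Require Import all_boot all_order all_algebra all_fingroup.
From mathcomp Require Import all_classical all_reals all_analysis.

Set Implicit Arguments.
Unset Strict Implicit.
Unset Printing Implicit Defensive.

Import Order.TTheory GRing.Theory Num.Theory.
Import numFieldNormedType.Exports.

Local Open Scope classical_set_scope.
Local Open Scope ring_scope.

Notation valuation R m := (m.-tuple (measurableTypeR R)).
Notation profile R n m := (n.-tuple (valuation R m)).

(* An allocation records the owner of each item; this encodes the 0/1
   matrices x with \sum_i x_(i, j) = 1 for every item j. *)
Notation allocation n m := {ffun 'I_m -> 'I_n}.

Section Valuations.
Context {R : realType} {m : nat}.
Implicit Types (v : valuation R m) (A B : {set 'I_m}).

Definition nonneg_valuation v := forall j, 0 <= tnth v j.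

Definition utility v A : R := \sum_(j in A) tnth v j.

Definition positive_items v : {set 'I_m} := [set j | 0 < tnth v j].

Definition better_ranked v : rel 'I_m :=
  fun j k => (tnth v k < tnth v j) || ((tnth v k == tnth v j) && (j <= k)%N).

Definition ranking v : seq 'I_m := sort (better_ranked v) (enum 'I_m).

Definition top_count v A l : nat := (\sum_(j <- take l (ranking v)) (j \in A))%N.

Definition sdp_ge v A B :=
  forall l, (0 < l <= #|positive_items v|)%N ->
    (top_count v B l <= top_count v A l)%N.

Definition sdp_gt v A B :=
  sdp_ge v A B /\
  exists2 l, (0 < l <= #|positive_items v|)%N &
    (top_count v B l < top_count v A l)%N.

End Valuations.

Section Allocations.
Context {R : realType} {n m : nat}.
Implicit Types (b : profile R n m) (x y : allocation n m).

Definition bundle x (i : 'I_n) : {set 'I_m} := [set j | x j == i].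

Definition EF1 b x := forall i j : 'I_n, bundle x j != finset.set0 ->
  exists2 g, g \in bundle x j &
    utility (tnth b i) (bundle x j :\ g)%SET <= utility (tnth b i) (bundle x i).

Definition sdp_efficient b x :=
  ~ exists y,
      (forall i, sdp_ge (tnth b i) (bundle y i) (bundle x i)) /\
      (exists i, sdp_gt (tnth b i) (bundle y i) (bundle x i)).

End Allocations.

Section RoundRobinPass.
Context {R : realType} {n m : nat}.
Variable b : profile R n m.

(* [s j] is the current owner of item [j], or [None] while [j] remains. *)
Implicit Type s : {ffun 'I_m -> option 'I_n}.

Definition rr_turn s (i : 'I_n) :=
  if [forall j in positive_items (tnth b i), s j != None] then s
  else if [seq j <- ranking (tnth b i) | s j == None] is j :: _ then
    [ffun k => if k == j then Some i else s k]
  else s.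

Definition rr_round s := foldl rr_turn s (enum 'I_n).

(* A round allocates an item as long as some remaining item is reported as
   positive by someone, and changes nothing otherwise: m rounds are enough to
   reach the stopping condition. *)
Definition rr_final := iter m rr_round [ffun => None].

Lemma rr_turn_mono s i j : s j != None -> rr_turn s i j = s j.
Proof.
rewrite /rr_turn => sj; case: ifP => // _.
case E : [seq _ <- _ | _] => [//|k r]; rewrite ffunE; case: eqP => // jk.
have : k \in [seq j <- ranking (tnth b i) | s j == None] by rewrite E mem_head.
by rewrite mem_filter -jk (negPf sj).
Qed.

Lemma rr_final_stops i j : rr_final j = None -> tnth (tnth b i) j <= 0.
Proof.
pose taken (s : {ffun 'I_m -> option 'I_n}) := [set k | s k != None]%SET.
have turnP s i0 : (taken s \subset taken (rr_turn s i0)).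
  by apply/fintype.subsetP => k; rewrite !inE => sk; rewrite rr_turn_mono.
have foldP r s : (taken s \subset taken (foldl rr_turn s r)).
  elim: r s => [//|k r IH] s /=; exact: fintype.subset_trans (turnP s k) (IH _).
have turn_lt s i0 k : k \in positive_items (tnth b i0) -> s k = None ->
    (#|taken s| < #|taken (rr_turn s i0)|)%N.
  move=> kp sk; apply: proper_card; rewrite properE turnP /=.
  rewrite /rr_turn; case: ifPn => [/forall_inP/(_ _ kp)|_]; first by rewrite sk.
  case E : [seq _ <- _ | _] => [|k' r].
    have : k \in [seq j <- ranking (tnth b i0) | s j == None].
      by rewrite mem_filter sk eqxx mem_sort mem_enum.
    by rewrite E.
  have : k' \in [seq j <- ranking (tnth b i0) | s j == None].
    by rewrite E mem_head.
  rewrite mem_filter => /andP[/eqP sk' _].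
  by apply/subsetPn; exists k'; rewrite !inE ?ffunE ?eqxx // sk'.
have fold_lt r s i0 k : i0 \in r -> k \in positive_items (tnth b i0) ->
    s k = None -> (#|taken s| < #|taken (foldl rr_turn s r)|)%N.
  elim: r s => [//|h r IH] s /=; rewrite inE => /orP[/eqP <-|ir] kp sk.
    by apply: leq_trans (turn_lt _ _ _ kp sk) (subset_leq_card (foldP _ _)).
  case sk' : (rr_turn s h k) => [a|]; last first.
    exact: leq_ltn_trans (subset_leq_card (turnP s h)) (IH _ ir kp sk').
  apply: leq_trans (subset_leq_card (foldP r _)); apply: proper_card.
  rewrite properE turnP; apply/subsetPn; exists k; by rewrite !inE ?sk' ?sk.
move=> rj; rewrite leNgt; apply/negP => jp.
have {}jp : j \in positive_items (tnth b i) by rewrite inE.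
have H t : (t <= m)%N -> (t <= #|taken (iter t rr_round [ffun => None])|)%N.
  elim: t => [//|t IH] tm /=; apply: leq_ltn_trans (IH (ltnW tm)) _.
  apply: (fold_lt _ _ i j) => //; first by rewrite mem_enum.
  case E : (iter t rr_round _ j) => [a|//].
  have sub u : taken (iter t rr_round [ffun => None])
      \subset taken (iter (u + t) rr_round [ffun => None]).
    elim: u => [//|u IHu] /=; exact: fintype.subset_trans IHu (foldP _ _).
  have /fintype.subsetP/(_ j) := sub (m - t)%N.
  by rewrite subnK ?(ltnW tm)// !inE E => /(_ isT); rewrite -/rr_final rj.
have := H m (leqnn m); rewrite leqNgt => /negP; apply.
rewrite -[X in (_ < X)%N](card_ord m) -cardsT; apply: proper_card.
rewrite properE finset.subsetT /=; apply/subsetPn; exists j; rewrite !inE //.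
by rewrite -/rr_final rj.
Qed.

End RoundRobinPass.

(* [leftover] is the deterministic rule, possibly depending on the whole
   reported profile, that allocates the remaining items. *)
Definition round_robin_pass {R : realType} {n m : nat}
    (leftover : profile R n m -> allocation n m) (b : profile R n m) :
    allocation n m :=
  [ffun j => odflt (leftover b j) (rr_final b j)].

Section ProductProbability.
Context {d : measure_display} {T : measurableType d} {R : realType}.
Local Open Scope ereal_scope.

Let cons_tuple n (p : T * n.-tuple T) : n.+1.-tuple T :=
  [the n.+1.-tuple T of p.1 :: p.2].

Let measurable_cons_tuple n : measurable_fun [set: _] (@cons_tuple n).
Proof. exact: measurable_cons. Qed.

HB.instance Definition _ n :=
  isMeasurableFun.Build _ _ _ _ (@cons_tuple n) (@measurable_cons_tuple n).

Fixpoint product_probability n : ('I_n -> probability T R) ->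
    probability (n.-tuple T) R :=
  match n with
  | 0 => fun=> dirac [tuple]
  | n'.+1 => fun P =>
      distribution (P ord0 \x product_probability (fun j => P (lift ord0 j)))
                   (@cons_tuple n')
  end.

Lemma product_probabilityE n (P : 'I_n -> probability T R) (A : 'I_n -> set T) :
  (forall i, measurable (A i)) ->
  product_probability P [set t | forall i, A i (tnth t i)] =
    \prod_(i < n) P i (A i).
Proof.
elim: n P A => [|n IH] P A mA.
  rewrite big_ord0 /= diracE mem_set //=; by case.
have mB : measurable [set t : n.-tuple T | forall i, A (lift ord0 i) (tnth t i)].
  rewrite [X in measurable X](_ : _ =
      \bigcap_(i in [set: 'I_n]) [set t : n.-tuple T | A (lift ord0 i) (tnth t i)]).
    apply: fin_bigcap_measurable => // i _.
    have := @measurable_tnth _ T n i measurableT _ (mA (lift ord0 i)).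
    by rewrite setTI.
  by apply/seteqP; split => t /= h i *; exact: h.
rewrite big_ord_recl -(IH (fun j => P (lift ord0 j))) //.
rewrite -product_measure1E //= /distribution /pushforward /=; congr (_ _).
apply/seteqP; split => [[x t] /= h|[x t] /= [h0 h] i].
  split; first exact: (h ord0).
  by move=> i; have := h (lift ord0 i); rewrite tnthS.
by have [j ->|->//] := unliftP ord0 i; rewrite tnthS.
Qed.

End ProductProbability.

Section Priors.
Context {R : realType} {n m : nat}.
Local Open Scope ereal_scope.

Definition neutral (D : probability (valuation R m) R) :=
  [/\ D [set v | nonneg_valuation v] = 1,
      forall s : 'S_m,
        D [set v | forall k l : 'I_m, (k < l)%N ->
                     (tnth v (s l) < tnth v (s k))%R] = (m`!%:R^-1)%:E &
      forall (j : 'I_m) (a : R), D [set v | tnth v j = a] = 0].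

(* The profile where agent [i] reports [b] and the others report [w]; the
   [j]-th entry of [w] belongs to agent [lift i j]. *)
Definition with_report (i : 'I_n) (b : valuation R m)
    (w : profile R n.-1 m) : profile R n m :=
  [tuple if unlift i k is Some j then tnth w j else b | k < n].

Definition others_prior (D : 'I_n -> probability (valuation R m) R) (i : 'I_n) :
    probability (profile R n.-1 m) R :=
  product_probability (fun j => D (lift i j)).

Definition BIC (D : 'I_n -> probability (valuation R m) R)
    (M : profile R n m -> allocation n m) :=
  forall (i : 'I_n) (v b : valuation R m),
    nonneg_valuation v -> nonneg_valuation b ->
    'E_(others_prior D i)[fun w => utility v (bundle (M (with_report i b w)) i)]
    <=
    'E_(others_prior D i)[fun w => utility v (bundle (M (with_report i v w)) i)].

End Priors.

(* Main.v *)
Require Import Defs.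
From mathcomp Require Import all_boot all_order all_algebra.
From mathcomp Require Import all_fingroup ring.
From mathcomp Require Import all_classical all_reals all_analysis.
From mathcomp Require Import measurable_realfun.

(* Incentives: the other agents' rankings are almost surely strict, positive and
   uniform, so only the list [p] of items from which agent [i] picks matters.
   Run by run, moving an item up in [p] can only help [i] get that item.  If [b]
   stands just before [a] in [p], swapping the two amounts to relabelling the
   items by the transposition (a b), which preserves the uniform distribution:
   the swap exchanges the winning probabilities of [a] and [b], and a comparison
   of [a] before and after shows that it shifts probability from [b] to [a].
   Hence sorting [p] by true value increases the expected utility, and so does
   appending a missing item at the end of [p], since it is only picked once [p]
   is exhausted.

   Efficiency: if [y] dominates the outcome, then by induction on the turns [y]
   agrees with every pick, as everything the picker ranks above her pick is
   already owned by the same agents in [y].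

   EF1: follow the turns of [i] and [j] alternately; each pick of [i] is worth
   at least as much to her as the next pick of [j]. *)

Set Implicit Arguments.
Unset Strict Implicit.
Unset Printing Implicit Defensive.

Import Order.TTheory GRing.Theory Num.Theory.

Local Open Scope ring_scope.

(** * Sequential picking from fixed preference lists *)

Lemma filter_consP (T : Type) (p : pred T) (l : seq T) g r :
  [seq j <- l | p j] = g :: r ->
  exists P Q, [/\ l = P ++ g :: Q, ~~ has p P & p g].
Proof.
elim: l => //= a l IH; case: ifP => [pa [<- _]|pa /IH[P [Q [-> hP pg]]]].
  by exists [::], l.
by exists (a :: P), Q; rewrite /= pa.
Qed.

Lemma sub_filter_nil (T : Type) (p q : pred T) (l : seq T) :
  subpred p q -> [seq j <- l | q j] = [::] -> [seq j <- l | p j] = [::].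
Proof.
move=> pq; elim: l => //= a l IH; case: ifP => // /negbT qa /IH ->.
by rewrite (contraNF (pq a) qa).
Qed.

Section Picks.
Context {A T : finType}.
Implicit Types (L : A -> seq T) (s : {ffun T -> option A}) (ts : seq A).

Definition pick_turn L s i :=
  if [seq j <- L i | s j == None] is j :: _ then
    [ffun k => if k == j then Some i else s k]
  else s.

Definition picks L s ts := foldl (pick_turn L) s ts.

Lemma pick_turn_mono L s i k a : s k = Some a -> pick_turn L s i k = Some a.
Proof.
rewrite /pick_turn => sk; case E : [seq _ <- _ | _] => [|j r] //.
rewrite ffunE; case: eqP => // kj.
have : j \in [seq j <- L i | s j == None] by rewrite E mem_head.
by rewrite mem_filter -kj sk.
Qed.

Lemma picks_mono L s ts k a : s k = Some a -> picks L s ts k = Some a.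
Proof. by elim: ts s => //= i ts IH s sk; exact/IH/pick_turn_mono. Qed.

Lemma eq_picks L L' s ts : L =1 L' -> picks L s ts = picks L' s ts.
Proof.
by move=> LL; elim: ts s => //= i ts IH s; rewrite /pick_turn LL IH.
Qed.

(** Owned items are never released, so a list without free items stays that way and [i] acquires
    nothing more. *)
Lemma picks_exhausted L s ts i k :
  [seq j <- L i | s j == None] = [::] -> picks L s ts k = Some i ->
  s k = Some i.
Proof.
elim: ts s => //= a ts IH s si /IH.
have si' : [seq j <- L i | pick_turn L s a j == None] = [::].
  apply: sub_filter_nil si => j /=; case sj : (s j) => [c|//].
  by rewrite (pick_turn_mono _ _ sj).
move=> /(_ si'); rewrite /pick_turn.
have [ai|ai] := eqVneq a i; first by rewrite ai si.
case: [seq _ <- _ | _] => [//|j r]; rewrite ffunE; case: eqP => // _ [ai'].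
by rewrite ai' eqxx in ai.
Qed.

(** The two runs coincide until a turn of [i] at which [P] is exhausted while [a] and [b] are both
    free. At that turn [i] takes [a] under [L'], and keeps it; what happens afterwards does not
    matter. *)
Lemma picks_promote L L' i a b P Q s ts :
  (forall k, k != i -> L' k = L k) ->
  L i = P ++ b :: a :: Q -> L' i = P ++ a :: b :: Q ->
  picks L s ts a = Some i -> picks L' s ts a = Some i.
Proof.
move=> LL' Li L'i; elim: ts s => //= k ts IH s.
have [->|ki] := eqVneq k i; last by rewrite /pick_turn LL'//; exact: IH.
rewrite /(pick_turn L') /(pick_turn L) L'i Li !filter_cat /=.
case: [seq j <- P | _] => [|j r] /=; last exact: IH.
case sa : (s a == None); case sb : (s b == None) => /=; try exact: IH.
by move=> _; apply: picks_mono; rewrite ffunE eqxx.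
Qed.

(** The two runs coincide until [i] picks [c], which requires [L i] to be exhausted. From then on
    [i] acquires nothing in either run, so her two bundles differ at most by [c], even if those of
    the other agents drift apart. *)
Lemma picks_append L L' i c s ts k :
  (forall k, k != i -> L' k = L k) -> L' i = rcons (L i) c ->
  (picks L s ts k = Some i -> picks L' s ts k = Some i) /\
  (picks L' s ts k = Some i -> k = c \/ picks L s ts k = Some i).
Proof.
move=> LL' L'i; elim: ts s => [|a ts IH] s /=; first by split=> // ->; right.
have [->|ai] := eqVneq a i; last by rewrite /pick_turn LL'//; exact: IH.
rewrite /(pick_turn L') /(pick_turn L) L'i filter_rcons.
case E : [seq j <- L i | _] => [|j r] /=; last by case: ifP => _; exact: IH.
case: ifP => [/eqP sc|_] /=; last exact: IH.
set s' := [ffun _ => _]; split=> [h|].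
  apply: picks_mono; rewrite ffunE; case: eqP => // _.
  exact: picks_exhausted h.
move=> h; have : s' k = Some i.
  apply: picks_exhausted h; rewrite L'i filter_rcons ffunE eqxx /=.
  by apply: sub_filter_nil E => j /=; rewrite ffunE; case: (j == c).
rewrite ffunE; case: eqP => [->|_ sk]; first by left.
by right; exact: picks_mono.
Qed.

Lemma picks_relabel (t : {perm T}) L L' s s' ts k :
  (forall i, L' i = map t (L i)) -> (forall j, s' (t j) = s j) ->
  picks L' s' ts (t k) = picks L s ts k.
Proof.
move=> LL'; elim: ts s s' => //= i ts IH s s' ss'; apply: IH => j.
have E : [seq j <- L' i | s' j == None] = map t [seq j <- L i | s j == None].
  by rewrite LL' filter_map; congr map; apply: eq_filter => x /=; rewrite ss'.
rewrite /pick_turn E; case: [seq _ <- _ | _] => //= h r.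
by rewrite !ffunE ss' (inj_eq perm_inj).
Qed.

End Picks.

(** * Rankings and their positive parts *)

Section Rankings.
Context {R : realType} {m : nat}.
Implicit Types v : valuation R m.

Definition positive_ranking v : seq 'I_m :=
  [seq j <- ranking v | j \in positive_items v].

Lemma better_ranked_total v : total (better_ranked v).
Proof.
move=> j k; rewrite /better_ranked.
by case: (ltgtP (tnth v j) (tnth v k)) => //= _; exact: leq_total.
Qed.

Lemma better_ranked_trans v : transitive (better_ranked v).
Proof.
rewrite /better_ranked => b a c.
move=> /orP[ba|/andP[/eqP<- ab]] /orP[cb|/andP[/eqP E bc]].
- by rewrite (lt_trans cb ba).
- by rewrite E ba.
- by rewrite cb.
- by rewrite E eqxx (leq_trans ab bc) orbT.
Qed.

Lemma better_ranked_anti v : antisymmetric (better_ranked v).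
Proof.
move=> a b /andP[]; rewrite /better_ranked.
case: (ltgtP (tnth v a) (tnth v b)) => //= _ ab ba.
by apply/val_inj/anti_leq; rewrite ab ba.
Qed.

Lemma better_ranked_le v j k : better_ranked v j k -> tnth v k <= tnth v j.
Proof. by case/orP=> [/ltW //|/andP[/eqP ->]]. Qed.

Lemma ranking_sorted v : sorted (better_ranked v) (ranking v).
Proof. exact/sort_sorted/better_ranked_total. Qed.

Lemma mem_ranking v j : j \in ranking v.
Proof. by rewrite mem_sort mem_enum. Qed.

Lemma ranking_uniq v : uniq (ranking v).
Proof. by rewrite sort_uniq enum_uniq. Qed.

Lemma mem_positive_ranking v j : (j \in positive_ranking v) = (0 < tnth v j).
Proof. by rewrite mem_filter mem_ranking andbT inE. Qed.

Lemma positive_ranking_uniq v : uniq (positive_ranking v).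
Proof. exact/filter_uniq/ranking_uniq. Qed.

Lemma positive_ranking_sorted v : sorted (better_ranked v) (positive_ranking v).
Proof. exact/(sorted_filter (@better_ranked_trans v))/ranking_sorted. Qed.

Lemma size_positive_ranking v : size (positive_ranking v) = #|positive_items v|.
Proof.
rewrite -(card_uniqP (positive_ranking_uniq v)); apply: eq_card => j.
by rewrite mem_positive_ranking inE.
Qed.

Lemma ranking_split v : ranking v =
  positive_ranking v ++ [seq j <- ranking v | j \notin positive_items v].
Proof.
apply: (sorted_eq (@better_ranked_trans v) (@better_ranked_anti v)).
- exact: ranking_sorted.
- rewrite sorted_pairwise; last exact: better_ranked_trans.
  rewrite pairwise_cat -!sorted_pairwise; try exact: better_ranked_trans.
  rewrite positive_ranking_sorted /=.
  rewrite (sorted_filter (@better_ranked_trans v)) ?ranking_sorted// andbT.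
  apply/allrelP => j k; rewrite mem_positive_ranking => vj.
  rewrite mem_filter inE -leNgt => /andP[vk _].
  by rewrite /better_ranked (le_lt_trans vk vj).
- by rewrite perm_sym; exact/permPl/perm_filterC.
Qed.

(** The SD+ comparisons stop at the number of positive items, and [ranking] starts with these items:
    the comparisons see exactly the list from which the agent picks. *)
Lemma top_countE v (B : {set 'I_m}) l : (l <= #|positive_items v|)%N ->
  top_count v B l = count (mem B) (take l (positive_ranking v)).
Proof.
move=> lm; rewrite /top_count ranking_split take_cat size_positive_ranking.
have -> : (if (l < #|positive_items v|)%N then take l (positive_ranking v) else
  positive_ranking v ++ take (l - #|positive_items v|)
  [seq j <- ranking v | j \notin positive_items v]) =
  take l (positive_ranking v).
  case: ltnP => // ml; have -> : l = #|positive_items v|.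
    by apply/eqP; rewrite eqn_leq lm.
  by rewrite subnn take0 cats0 -size_positive_ranking take_size.
rewrite -sum1_count [RHS]big_mkcond; apply: eq_bigr => j _ /=.
by case: (j \in B).
Qed.

Lemma ranking_perm v (s : 'S_m) :
  (forall k l : 'I_m, (k < l)%N -> tnth v (s l) < tnth v (s k)) ->
  ranking v = map s (enum 'I_m).
Proof.
move=> vs; apply: (sorted_eq (@better_ranked_trans v) (@better_ranked_anti v)).
- exact: ranking_sorted.
- rewrite sorted_map; apply: (sub_sorted (e := fun j k : 'I_m => (j < k)%N)).
    by move=> j k jk; rewrite /= /better_ranked vs.
  by have := iota_ltn_sorted 0 m; rewrite -val_enum_ord sorted_map.
- apply: uniq_perm; rewrite ?ranking_uniq ?(map_inj_uniq perm_inj) ?enum_uniq//.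
  move=> j; rewrite mem_ranking; apply/esym/mapP; exists (s^-1%g j).
    by rewrite mem_enum.
  by rewrite permKV.
Qed.

End Rankings.

(** * The mechanism as sequential picking *)

Section RoundRobinAsPicks.
Context {R : realType} {n m : nat}.
Implicit Types b : profile R n m.

Definition positive_rankings b (i : 'I_n) := positive_ranking (tnth b i).

Definition unowned : {ffun 'I_m -> option 'I_n} := [ffun => None].

Definition turns : seq 'I_n := flatten (nseq m (enum 'I_n)).

(** Cutting the zero-valued tail off the ranking builds the skipping rule into the list: no free
    item is left on it exactly when the turn is skipped. *)
Lemma rr_turnE b s i : rr_turn b s i = pick_turn (positive_rankings b) s i.
Proof.
rewrite /rr_turn /pick_turn ranking_split filter_cat.
case: ifPn => [/forall_inP all_taken|/forall_inPn[j jp /negPn sj]].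
  case E : [seq j <- _ | _] => [//|j r].
  have : j \in [seq j <- positive_rankings b i | s j == None].
    by rewrite E mem_head.
  rewrite mem_filter mem_positive_ranking => /andP[/eqP sj jp].
  by have := all_taken j; rewrite inE jp sj => /(_ isT).
rewrite /positive_rankings; case E : [seq j <- positive_ranking _ | _] => [|//].
have : j \in [seq j <- positive_ranking (tnth b i) | s j == None].
  by rewrite mem_filter sj mem_positive_ranking; move: jp; rewrite inE.
by rewrite E.
Qed.

Lemma rr_roundE b s : rr_round b s = picks (positive_rankings b) s (enum 'I_n).
Proof.
rewrite /rr_round; elim: (enum 'I_n) s => //= i r IH s.
by rewrite IH rr_turnE.
Qed.

Lemma rr_finalE b : rr_final b = picks (positive_rankings b) unowned turns.
Proof.
suff H t s : iter t (rr_round b) s =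
    picks (positive_rankings b) s (flatten (nseq t (enum 'I_n))) by exact: H.
elim: t s => //= t IH s.
by rewrite -iterS iterSr IH /picks foldl_cat -/(picks _ s _) -rr_roundE.
Qed.

End RoundRobinAsPicks.

Arguments turns n m : clear implicits.

(** * SD+ efficiency *)

Section Efficiency.
Context {A T : finType}.

Lemma picks_forced (L : A -> seq T) (y : {ffun T -> A})
    (s : {ffun T -> option A}) ts :
  (forall k a, s k = Some a -> y k = a) ->
  (forall i l, (l <= size (L i))%N ->
     (count (fun k => picks L s ts k == Some i) (take l (L i)) <=
      count (fun k => y k == i) (take l (L i)))%N) ->
  forall k a, picks L s ts k = Some a -> y k = a.
Proof.
elim: ts s => //= i ts IH s sy dom; apply: IH; last exact: dom.
rewrite /pick_turn; case E : [seq _ <- _ | _] => [//|g r] k a.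
rewrite ffunE; case: eqP => [->{k} [<-{a}]|_]; last exact: sy.
have [P [Q [Li Pfree sg]]] := filter_consP E.
(* Compare counts on the prefix of [L i] that ends with the pick [g]. All of [P] is owned already,
   and [y] agrees there, so both sides count the same items of [P]; as the final outcome also counts
   [g], so must [y]. *)
have := dom i (size P).+1.
rewrite Li -cat_rcons size_cat size_rcons leq_addr => /(_ isT).
rewrite take_size_cat ?size_rcons// -cats1 !count_cat /=.
rewrite (@picks_mono _ _ _ _ _ g i); last first.
  by rewrite /pick_turn E ffunE eqxx.
rewrite eqxx !addn0 (@eq_in_count _ _ (fun k => y k == i)) ?leq_add2l.
  by case: eqP.
move=> k kP; case sk : (s k) => [a|]; last first.
  by move/hasPn: Pfree => /(_ k kP); rewrite sk.
by rewrite (@picks_mono _ _ _ _ _ k a) ?(sy _ _ sk) //; exact: pick_turn_mono.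
Qed.

End Efficiency.

Lemma round_robin_pass_sdp_efficient {R : realType} {n m : nat}
    (leftover : profile R n m -> allocation n m) (b : profile R n m) :
  sdp_efficient b (round_robin_pass leftover b).
Proof.
move=> [y [y_ge [i [_ [l /andP[_ lm]]]]]].
(* Every item that some agent values positively is picked in the end, so [leftover] is invisible on
   the lists that SD+ inspects. *)
have owned k j : j \in positive_rankings b k -> rr_final b j != None.
  rewrite mem_positive_ranking => vj; apply/eqP => /(rr_final_stops k).
  by rewrite leNgt vj.
have xE k j : j \in positive_rankings b k ->
    (j \in bundle (round_robin_pass leftover b) k) = (rr_final b j == Some k).
  by move=> /owned; rewrite inE ffunE; case: (rr_final b j).
have yE : forall j a, rr_final b j = Some a -> y j = a.
  rewrite rr_finalE; apply: picks_forced => [j a|k t]; first by rewrite ffunE.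
  rewrite -rr_finalE => tk; case: t tk => [|t] tk; first by rewrite take0.
  have := y_ge k t.+1; rewrite -size_positive_ranking tk => /(_ isT).
  rewrite !top_countE -?size_positive_ranking // => tc.
  rewrite (eq_in_count (a2 := mem (bundle (round_robin_pass leftover b) k))).
    apply: leq_trans tc _; apply: sub_count => j /=; by rewrite inE.
  by move=> j /mem_take jk; rewrite /= xE.
(* Since [y] agrees with every pick, the counts for [i] coincide and the strict inequality fails. *)
rewrite !top_countE // ltnNge => /negP; apply.
apply: eq_leq; apply: eq_in_count => j /mem_take jk /=.
rewrite xE // inE; have := owned _ _ jk; case E : (rr_final b j) => [a|//] _.
by rewrite (yE _ _ E).
Qed.

(** * Envy-freeness up to one item *)

Section EnvyFreeness.
Context {R : realType} {A T : finType}.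
Variables (v : T -> R) (L : A -> seq T) (i j : A).
Hypotheses (v_ge0 : forall k, 0 <= v k).
Hypothesis L_pos : forall k, (k \in L i) = (0 < v k).
Hypothesis L_sorted : pairwise (fun k l => v l <= v k) (L i).
Hypothesis ij : i != j.
Implicit Type s : {ffun T -> option A}.

(** Every bundle is valued through the eyes of [i], by [v]; [Um] is the value of a bundle minus the
    item [g]. *)
Let U s a := \sum_(k | s k == Some a) v k.
Let Um s a g := \sum_(k | (s k == Some a) && (k != g)) v k.

(* [settled]: [nonenvious] will survive the next pick of [j], whatever it is. *)
Let nonenvious s := (forall k, s k != Some j) \/
  exists2 g, s g = Some j & Um s j g <= U s i.
Let settled s := (forall k, s k != Some j) \/
  exists2 g, s g = Some j & Um s j g <= U s i /\
    forall k, s k = None -> Um s j g + v k <= U s i.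

Let settled_nonenvious s : settled s -> nonenvious s.
Proof. by case=> [|[g sg [? _]]]; [left|right; exists g]. Qed.

Variant pick_turn_spec s a : {ffun T -> option A} -> Prop :=
| PickNone of [seq k <- L a | s k == None] = [::] : pick_turn_spec s a s
| PickSome g r of [seq k <- L a | s k == None] = g :: r & s g = None :
    pick_turn_spec s a [ffun k => if k == g then Some a else s k].

Lemma pick_turnP s a : pick_turn_spec s a (pick_turn L s a).
Proof.
rewrite /pick_turn; case E : [seq _ <- _ | _] => [|g r]; first exact: PickNone.
have : g \in [seq j <- L a | s j == None] by rewrite E mem_head.
by rewrite mem_filter => /andP[/eqP sg _]; exact: PickSome E sg.
Qed.

Let U_other s a c g : s g = None -> a != c ->
  U [ffun k => if k == g then Some a else s k] c = U s c.
Proof.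
move=> sg ac; apply: eq_bigl => k; rewrite ffunE; have [->|//] := eqVneq k g.
by rewrite sg; apply/negbTE; apply: contra ac => /eqP[->].
Qed.

Let Um_other s a c g h : s g = None -> a != c ->
  Um [ffun k => if k == g then Some a else s k] c h = Um s c h.
Proof.
move=> sg ac; apply: eq_bigl => k; rewrite ffunE; have [->|//] := eqVneq k g.
by rewrite sg; apply/negbTE/nandP; left; apply: contra ac => /eqP[->].
Qed.

Let U_self s a g : s g = None ->
  U [ffun k => if k == g then Some a else s k] a = v g + U s a.
Proof.
move=> sg; rewrite /U (bigD1 g) ?ffunE ?eqxx //=; congr (_ + _).
apply: eq_bigl => k; rewrite ffunE.
by have [->|_] := eqVneq k g; rewrite ?sg ?andbF ?andbT.
Qed.

Let Um_self s a g h : s g = None -> h != g ->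
  Um [ffun k => if k == g then Some a else s k] a h = Um s a h + v g.
Proof.
move=> sg hg; rewrite addrC /Um (bigD1 g) /=; last first.
  by rewrite ffunE eqxx eqxx eq_sym.
congr (_ + _); apply: eq_bigl => k; rewrite ffunE.
by have [->|_] := eqVneq k g; rewrite ?sg ?andbF ?andbT.
Qed.

Let none_other s a g : (forall k, s k != Some j) -> a != j ->
  forall k, [ffun k => if k == g then Some a else s k] k != Some j.
Proof.
move=> sj aj k; rewrite ffunE; have [_|//] := eqVneq k g.
by apply: contra aj => /eqP[->].
Qed.

Let U_mono s a : U s i <= U (pick_turn L s a) i.
Proof.
case: pick_turnP => // g r _ sg.
have [->|ai] := eqVneq a i; first by rewrite U_self // lerDr.
by rewrite U_other.
Qed.

Let nonenvious_turn s a : a != j -> nonenvious s ->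
  nonenvious (pick_turn L s a).
Proof.
move=> aj; have := U_mono s a; case: pick_turnP => // g r _ sg Us.
case=> [sj|[h sh hU]]; first by left; exact: none_other.
right; exists h; last by rewrite Um_other // (le_trans hU).
by rewrite ffunE; have [hg|//] := eqVneq h g; rewrite -hg sh in sg.
Qed.

Let settled_turn s a : a != j -> settled s -> settled (pick_turn L s a).
Proof.
move=> aj; have := U_mono s a; case: pick_turnP => // g r _ sg Us.
case=> [sj|[h sh [hU hk]]]; first by left; exact: none_other.
right; exists h.
  by rewrite ffunE; have [hg|//] := eqVneq h g; rewrite -hg sh in sg.
rewrite Um_other //; split; first exact: le_trans hU Us.
move=> k; rewrite ffunE; have [//|_ sk] := eqVneq k g.
exact: le_trans (hk _ sk) Us.
Qed.

(** Either [i] picks an item that is worth at least as much to her as any item still free, which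
    pays in advance for the next pick of [j], or nothing is left on her list and every free item is
    worth zero to her. *)
Let turn_settles s : nonenvious s -> settled (pick_turn L s i).
Proof.
have top g r k : [seq k <- L i | s k == None] = g :: r -> s k = None ->
    v k <= v g.
  move=> E sk; have [vk|vk] := ltP 0 (v k); last exact: le_trans vk (v_ge0 g).
  have : k \in [seq k <- L i | s k == None] by rewrite mem_filter sk L_pos.
  have sub := filter_subseq (fun k => s k == None) (L i).
  have /= := subseq_pairwise sub L_sorted.
  rewrite E /= => /andP[/allP gr _]; rewrite inE => /predU1P[->//|/gr //].
case: pick_turnP => [E|g r E sg].
  case=> [sj|[h sh hU]]; [by left|right; exists h => //; split=> // k sk].
  suff -> : v k = 0 by rewrite addr0.
  apply/eqP; rewrite eq_le v_ge0 andbT leNgt -L_pos; apply/negP => kL.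
  have : k \in [seq k <- L i | s k == None] by rewrite mem_filter sk kL.
  by rewrite E.
case=> [sj|[h sh hU]]; first by left; exact: none_other.
right; exists h.
  by rewrite ffunE; have [hg|//] := eqVneq h g; rewrite -hg sh in sg.
rewrite Um_other // U_self //; split; first by rewrite (le_trans hU) // lerDr.
move=> k; rewrite ffunE; have [//|_ sk] := eqVneq k g.
by rewrite addrC lerD // (top _ _ _ E).
Qed.

(** The first pick of [j] becomes the item to remove; any later pick is paid for by the slack in
    [settled]. *)
Let turn_unsettles s : settled s -> nonenvious (pick_turn L s j).
Proof.
case: pick_turnP => [_|g r _ sg]; first exact: settled_nonenvious.
case=> [sj|[h sh [hU hk]]]; right.
  exists g; first by rewrite ffunE eqxx.
  rewrite /Um big1 ?sumr_ge0// => k; rewrite ffunE.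
  have [_|_] := eqVneq k g; first by rewrite andbF.
  by rewrite (negPf (sj k)).
have hg : h != g by apply/eqP => hg; rewrite -hg sh in sg.
exists h; first by rewrite ffunE (negPf hg).
by rewrite Um_self // U_other 1?eq_sym// hk.
Qed.

Let picks_nonenvious s ts : j \notin ts -> nonenvious s ->
  nonenvious (picks L s ts).
Proof.
elim: ts s => //= a ts IH s; rewrite inE negb_or eq_sym => /andP[aj tsj] sE.
exact: IH tsj (nonenvious_turn aj sE).
Qed.

Let picks_settled s ts : j \notin ts -> settled s -> settled (picks L s ts).
Proof.
elim: ts s => //= a ts IH s; rewrite inE negb_or eq_sym => /andP[aj tsj] sE.
exact: IH tsj (settled_turn aj sE).
Qed.

Lemma picks_rounds_EF1 s r t : uniq r -> i \in r -> j \in r ->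
  (forall k, s k != Some j) ->
  let f := picks L s (flatten (nseq t r)) in
  (forall k, f k != Some j) \/
  exists2 g, f g = Some j &
    \sum_(k | (f k == Some j) && (k != g)) v k <= \sum_(k | f k == Some i) v k.
Proof.
move=> r_uniq ir jr sj /=; rewrite -/(nonenvious _).
have sS : settled s by left.
case/splitPr: ir r_uniq jr => p q;  rewrite cat_uniq mem_cat inE.
move=> /and3P[p_uniq /norP[_ pq] /= /andP[iq q_uniq]].
rewrite [j == i]eq_sym (negPf ij) /= => jpq.
(* The order of [i] and [j] within a round decides which invariant holds between rounds: [settled]
   if [j] acts first, [nonenvious] if [i] does. Both hold at the start, when [j] owns nothing. *)
have [jp|jp] := boolP (j \in p).
  have jq : j \notin q by apply: contra pq => jq; apply/hasP; exists j.
  apply: settled_nonenvious; elim: t s sS {sj} => //= t IH s sS.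
  rewrite /picks !foldl_cat; apply: IH; rewrite /=.
  apply: picks_settled => //; apply: turn_settles.
  case/splitPr: {pq jpq} jp p_uniq => p1 p2; rewrite cat_uniq /=.
  move=> /and3P[_ /norP[jp1 _] /andP[jp2 _]].
  rewrite foldl_cat /=; apply: picks_nonenvious => //; apply: turn_unsettles.
  exact: picks_settled.
have jq : j \in q by move: jpq; rewrite (negPf jp).
have {sj}sE : nonenvious s by left.
elim: t s sE {sS} => //= t IH s sE.
rewrite /picks !foldl_cat; apply: IH; rewrite /=.
case/splitPr: {pq jpq iq} jq q_uniq => q1 q2; rewrite cat_uniq /=.
move=> /and3P[_ /norP[jq1 _] /andP[jq2 _]].
rewrite foldl_cat /=; apply: picks_nonenvious => //; apply: turn_unsettles.
apply: picks_settled => //; apply: turn_settles.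
exact: picks_nonenvious.
Qed.

End EnvyFreeness.

Lemma round_robin_pass_EF1 {R : realType} {n m : nat}
    (leftover : profile R n m -> allocation n m) (b : profile R n m) :
  (forall i, nonneg_valuation (tnth b i)) ->
  EF1 b (round_robin_pass leftover b).
Proof.
move=> b_ge0 i j; set x := round_robin_pass _ _ => /set0Pn[g0 g0j].
have v_ge0 := b_ge0 i; set v := tnth b i in v_ge0 *.
(* Items assigned by [leftover] are worth zero to every agent, so utilities only depend on the
   picks. *)
have v_eq0 k : rr_final b k = None -> tnth v k = 0.
  by move=> /(rr_final_stops i) vk; apply/eqP; rewrite eq_le v_ge0 vk.
have utilE a : utility v (bundle x a) =
    \sum_(k | rr_final b k == Some a) tnth v k.
  rewrite /utility big_mkcond [RHS]big_mkcond; apply: eq_bigr => k _.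
  rewrite inE ffunE; case E : (rr_final b k) => //=.
  by rewrite v_eq0 //; case: ifP.
have utilmE a g : utility v (bundle x a :\ g)%SET =
    \sum_(k | (rr_final b k == Some a) && (k != g)) tnth v k.
  rewrite /utility big_mkcond [RHS]big_mkcond; apply: eq_bigr => k _.
  rewrite !inE ffunE andbC; case E : (rr_final b k) => //=.
  by rewrite v_eq0 //; case: ifP.
have [ij|ij] := eqVneq i j; first rewrite -ij in g0j *.
  exists g0 => //; rewrite utilmE utilE [leRHS]big_mkcond [leLHS]big_mkcond.
  by apply: ler_sum => k _; case: (_ == _) => //=; case: ifP.
have sorted_v :
    pairwise (fun k l => tnth v l <= tnth v k) (positive_rankings b i).
  apply: (sub_pairwise (r := better_ranked v)); first exact: better_ranked_le.
  rewrite -sorted_pairwise ?positive_ranking_sorted //.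
  exact: better_ranked_trans.
have none0 (k : 'I_m) : @unowned n m k != Some j by rewrite ffunE.
have := @picks_rounds_EF1 R 'I_n 'I_m (tnth v) (positive_rankings b) i j v_ge0
  (mem_positive_ranking v) sorted_v ij unowned (enum 'I_n) m (enum_uniq _)
  (mem_enum _ _) (mem_enum _ _) none0.
(* If [j] never picked, her bundle comes from [leftover] alone and is worthless to [i], so any of
   its items can be removed. *)
rewrite /= -/(turns n m) -rr_finalE => -[fj|[g fg le_g]].
  exists g0 => //; rewrite utilmE utilE big1 ?sumr_ge0 // => k.
  by rewrite (negPf (fj k)).
exists g; first by rewrite inE ffunE fg.
by rewrite utilmE utilE.
Qed.

(** * Incentives against uniformly random rankings *)

Section Incentives.
Context {R : realType} {n m : nat}.
Variables (i : 'I_n) (ts : seq 'I_n).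
Implicit Types (p P Q : seq 'I_m) (w : {ffun 'I_n.-1 -> 'S_m}).
Implicit Types (a b c k : 'I_m) (v : valuation R m).

(** A permutation stands for the strict ranking of another agent: [w j] lists the items of agent
    [lift i j] from best to worst, all of them being positive. *)
Definition report_lists p w (k : 'I_n) : seq 'I_m :=
  if unlift i k is Some j then map (w j) (enum 'I_m) else p.

Definition wins p w k := picks (report_lists p w) unowned ts k == Some i.

(* Up to the factor [1 / m!^(n-1)], the probability that agent [i] gets [k]. *)
Definition win_count p k : nat := (\sum_w wins p w k)%N.

(** Up to the same factor, this is the expected utility of agent [i] when she picks from [p]. *)
Definition gain v p : R := \sum_w \sum_(k | wins p w k) tnth v k.

Lemma gainE v p : gain v p = \sum_k tnth v k *+ win_count p k.
Proof.
rewrite /gain (exchange_big_dep xpredT) //=; apply: eq_bigr => k _.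
rewrite -sumrMnr big_mkcond; apply: eq_bigr => w _.
by case: (wins p w k).
Qed.

Lemma report_lists_self p w : report_lists p w i = p.
Proof. by rewrite /report_lists unlift_none. Qed.

Lemma report_lists_other p q w (k : 'I_n) : k != i ->
  report_lists p w k = report_lists q w k.
Proof. by rewrite eq_sym /report_lists => /unlift_some[j -> ->]. Qed.

(** Composing all rankings with [t] is a bijection of the ranking profiles, and it turns each run
    into its relabelling. This is where uniformity of the rankings enters. *)
Lemma win_count_relabel (t : 'S_m) p k :
  win_count (map t p) (t k) = win_count p k.
Proof.
pose h w : {ffun 'I_n.-1 -> 'S_m} := [ffun j => (w j * t)%g].
rewrite /win_count (reindex h) /=; last first.
  exists (fun w => [ffun j => (w j * t^-1)%g]) => w _; apply/ffunP => j.
    by rewrite !ffunE mulgK.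
  by rewrite !ffunE mulgKV.
apply: eq_bigr => w _; rewrite /wins.
rewrite (@picks_relabel _ _ t (report_lists p w) _ unowned) //.
  move=> j; rewrite /report_lists; case: unlift => // l.
  by rewrite ffunE -[RHS]map_comp; apply: eq_map => x; rewrite permM.
by move=> j; rewrite !ffunE.
Qed.

Lemma gain_promote v P Q a b : uniq (P ++ b :: a :: Q) ->
  tnth v b <= tnth v a ->
  gain v (P ++ b :: a :: Q) <= gain v (P ++ a :: b :: Q).
Proof.
move=> uniq_p ba; set p := P ++ _; set p' := P ++ _.
have [bP aP bQ aQ bNa] :
    [/\ b \notin P, a \notin P, b \notin Q, a \notin Q & b != a].
  move: uniq_p; rewrite cat_uniq /= !inE !negb_or.
  by case/and3P=> _ /and3P[-> -> _] /and3P[/andP[-> ->] -> _].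
have tp : p' = map (tperm a b) p.
  rewrite /p' /p map_cat /= tpermL tpermR; congr (_ ++ [:: _, _ & _]).
    rewrite -[LHS]map_id; apply/eq_in_map => k kP; rewrite tpermD //.
      by apply: contraNneq aP => ->.
    by apply: contraNneq bP => ->.
  rewrite -[LHS]map_id; apply/eq_in_map => k kQ; rewrite tpermD //.
    by apply: contraNneq aQ => ->.
  by apply: contraNneq bQ => ->.
have Na : win_count p' a = win_count p b.
  by rewrite tp -(win_count_relabel (tperm a b) p b) tpermR.
have Nb : win_count p' b = win_count p a.
  by rewrite tp -(win_count_relabel (tperm a b) p a) tpermL.
have Nk k : k != a -> k != b -> win_count p' k = win_count p k.
  move=> ka kb; rewrite tp -(win_count_relabel (tperm a b) p k).
  by rewrite tpermD // eq_sym.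
(* Moving [a] up never loses it; [Na] turns this into a comparison of two counts for the same list
   [p]. *)
have Nab : (win_count p a <= win_count p b)%N.
  rewrite -Na; apply: leq_sum => w _; rewrite /wins; case: eqP => // Hp.
  rewrite (@picks_promote _ _ (report_lists p w) _ i a b P Q) ?eqxx //;
    rewrite ?report_lists_self //.
  by move=> k; exact: report_lists_other.
have sumD (f : 'I_m -> R) :
    \sum_k f k = f a + (f b + \sum_(k | (k != a) && (k != b)) f k).
  by rewrite (bigD1 a) //= (bigD1 b).
rewrite !gainE !sumD Na Nb.
rewrite [X in _ <= _ + (_ + X)](eq_bigr (fun k => tnth v k *+ win_count p k)).
  rewrite !addrA lerD2r -subr_ge0.
  rewrite -![tnth v _ *+ _]mulr_natr.
  have -> : tnth v a * (win_count p b)%:R + tnth v b * (win_count p a)%:R -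
    (tnth v a * (win_count p a)%:R + tnth v b * (win_count p b)%:R) =
    (tnth v a - tnth v b) * ((win_count p b)%:R - (win_count p a)%:R) by ring.
  by rewrite mulr_ge0 // subr_ge0 // ler_nat.
by move=> k /andP[ka kb]; rewrite Nk.
Qed.

Lemma win_count_rcons p c k :
  (win_count p k <= win_count (rcons p c) k)%N /\
  (k != c -> win_count (rcons p c) k = win_count p k).
Proof.
have app w : (wins p w k -> wins (rcons p c) w k) /\
    (wins (rcons p c) w k -> k = c \/ wins p w k).
  have [h1 h2] := @picks_append _ _ (report_lists p w)
    (report_lists (rcons p c) w) i c unowned ts k
    (fun j => @report_lists_other _ _ w j)
    (etrans (report_lists_self _ _)
            (congr1 (rcons^~ c) (esym (report_lists_self _ _)))).
  by split=> /eqP; [move/h1/eqP|case/h2=> [|/eqP]; [left|right]].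
split=> [|kc].
  by apply: leq_sum => w _; case E : (wins p w k) => //; rewrite (app w).1.
apply: eq_bigr => w _; congr nat_of_bool; apply/idP/idP => [/(app w).2[]//|].
  by move/eqP; rewrite (negPf kc).
exact: (app w).1.
Qed.

Lemma gain_cat v p q : (forall k, k \in q -> 0 <= tnth v k) ->
  gain v p <= gain v (p ++ q).
Proof.
elim/last_ind: q => [|q c IH] q_ge0; first by rewrite cats0.
apply: le_trans (IH _) _ => [k kq|].
  by apply: q_ge0; rewrite mem_rcons inE kq orbT.
rewrite -rcons_cat !gainE; apply: ler_sum => k _.
have [Nle Neq] := win_count_rcons (p ++ q) c k.
have [kc|/Neq -> //] := eqVneq k c.
by rewrite ler_wpMn2l // kc q_ge0 // mem_rcons mem_head.
Qed.

Lemma gain_cat0 v p q : (forall k, k \in q -> tnth v k = 0) ->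
  gain v (p ++ q) = gain v p.
Proof.
elim/last_ind: q => [|q c IH] q0; first by rewrite cats0.
rewrite -IH => [|k kq]; last by apply: q0; rewrite mem_rcons inE kq orbT.
rewrite -rcons_cat !gainE; apply: eq_bigr => k _.
have [_ Neq] := win_count_rcons (p ++ q) c k.
have [kc|/Neq -> //] := eqVneq k c.
by rewrite kc q0 ?mul0rn // mem_rcons mem_head.
Qed.

(** The inner loop of insertion sort: [x] moves right by adjacent swaps, each justified by
    [gain_promote]. The prefix [P] is arbitrary because it absorbs the items that [x] has passed. *)
Lemma gain_insert v P x S : sorted (better_ranked v) S -> uniq (P ++ x :: S) ->
  exists S', [/\ perm_eq S' (x :: S), sorted (better_ranked v) S' &
    gain v (P ++ x :: S) <= gain v (P ++ S')].
Proof.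
elim: S P => [|y S IH] P S_sorted uniq_p; first by exists [:: x].
have [xy|yx] := boolP (better_ranked v x y).
  by exists [:: x, y & S]; split=> //=; rewrite xy.
have {}yx : better_ranked v y x.
  by have := better_ranked_total v x y; rewrite (negPf yx).
have swap : perm_eq [:: y, x & S] [:: x, y & S].
  by rewrite -[[:: y, x & S]]/([:: y] ++ [:: x] ++ S) perm_catCA.
have uniq_p' : uniq (rcons P y ++ x :: S).
  by rewrite cat_rcons (perm_uniq (s2 := P ++ [:: x, y & S])) // perm_cat2l.
move: S_sorted; rewrite /= path_sortedE; last exact: better_ranked_trans.
move=> /andP[yS S_sorted].
have [S' [permS' sortedS' gainS']] := IH _ S_sorted uniq_p'.
exists (y :: S'); split.
- by apply: perm_trans swap; rewrite perm_cons.
- rewrite /= path_sortedE ?sortedS' ?andbT; last exact: better_ranked_trans.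
  by rewrite (perm_all _ permS') /= yx.
- apply: le_trans (gain_promote uniq_p (better_ranked_le yx)) _.
  by rewrite -!(cat_rcons y).
Qed.

Lemma gain_sort v P p : uniq (P ++ p) ->
  exists S, [/\ perm_eq S p, sorted (better_ranked v) S &
    gain v (P ++ p) <= gain v (P ++ S)].
Proof.
elim: p P => [|x p IH] P uniq_p; first by exists [::].
have [|S [permS sortedS gainS]] := IH (rcons P x); first by rewrite cat_rcons.
have [|S' [permS' sortedS' gainS']] := @gain_insert v P x S sortedS.
  by rewrite (perm_uniq (s2 := P ++ x :: p)) // perm_cat2l perm_cons.
exists S'; split=> //.
  by rewrite (permPl permS') perm_cons.
by apply: le_trans gainS'; rewrite -!cat_rcons.
Qed.

(** Full rankings are the common ground. Completing the list of [r] by the missing items does not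
    hurt, as [v] is nonnegative; sorting the result by [v] gives [ranking v]; dropping its
    zero-valued tail changes nothing. *)
Lemma gain_truthful v (r : valuation R m) : nonneg_valuation v ->
  gain v (positive_ranking r) <= gain v (positive_ranking v).
Proof.
move=> v_ge0.
have -> : gain v (positive_ranking v) = gain v (ranking v).
  rewrite ranking_split gain_cat0 // => k; rewrite mem_filter inE -leNgt.
  by case/andP=> vk _; apply/eqP; rewrite eq_le vk v_ge0.
apply: (@le_trans _ _ (gain v (ranking r))).
  by rewrite ranking_split; apply: gain_cat => k _; exact: v_ge0.
have [S [permS sortedS]] := @gain_sort v [::] _ (ranking_uniq r).
rewrite /= => /le_trans; apply; suff -> : S = ranking v by [].
apply: (sorted_eq (@better_ranked_trans _ _ v) (@better_ranked_anti _ _ v)).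
- exact: sortedS.
- exact: ranking_sorted.
- rewrite (permPl permS); apply: uniq_perm; rewrite ?ranking_uniq // => k.
  by rewrite !mem_ranking.
Qed.

End Incentives.

(** * Expectation of a function constant on each event of a partition *)

Section Expectation.
Context {d : measure_display} {T : measurableType d} {R : realType}.
Local Open Scope classical_set_scope.
Local Open Scope ereal_scope.

(** The integral of a nonnegative function is a supremum over the simple functions below it, which
    is monotone without any measurability. *)
Lemma ge0_le_integral_nonmeasurable (mu : {measure set T -> \bar R})
    (f g : T -> \bar R) :
  (forall x, 0 <= f x) -> (forall x, f x <= g x) ->
  \int[mu]_x f x <= \int[mu]_x g x.
Proof.
move=> f0 fg; rewrite !ge0_integralTE //; last first.
  by move=> x; exact: le_trans (f0 x) (fg x).
apply: ereal_sup_le => _ [h hf <-]; exists h => // x.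
exact: le_trans (hf x) (fg x).
Qed.

(* [X] is not assumed to be measurable off the partition: on the null set
   where the mechanism calls [leftover], nothing is known about it. *)
Lemma expectation_partition (P : probability T R) (I : finType)
    (E : I -> set T) (c : I -> R) (X : T -> R) :
  (forall i, measurable (E i)) ->
  (forall i j x, E i x -> E j x -> i = j) ->
  \sum_i P (E i) = 1 ->
  (forall i, 0 <= c i)%R -> (forall x, 0 <= X x)%R ->
  (forall i x, E i x -> X x = c i) ->
  'E_P[X] = \sum_i (c i)%:E * P (E i).
Proof.
move=> mE Einj PE c0 X0 XE.
pose D := \bigcup_i E i.
have mD : measurable D by exact: fin_bigcup_measurable.
have finI : finite_set [set: I] by exact: finite_finset.
have setTE : [set: I] = [set` index_enum I].
  by apply/seteqP; split=> i //= _; exact: mem_index_enum.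
(* The events are disjoint and their probabilities add up to 1. *)
have PD : P (~` D) = 0.
  rewrite probability_setC // measure_fin_bigcup //; last first.
    apply/trivIsetP => i j _ _ /eqP ij; apply/seteqP.
    by split=> x //= [/Einj h /h].
  rewrite setTE -fsbig_seq ?index_enum_uniq //= PE.
  by rewrite subee.
pose term i : T -> \bar R := fun x => (c i)%:E * (\1_(E i) x)%:E.
pose S x : \bar R := \sum_i term i x.
have term0 i x : 0 <= term i x by rewrite mule_ge0 // lee_fin.
have mterm i : measurable_fun setT (term i).
  by apply: measurable_funeM; exact/measurable_EFinP/measurable_indic.
have S0 x : 0 <= S x by exact: sume_ge0.
have SE i x : E i x -> S x = (c i)%:E.
  move=> Eix; rewrite /S /term (bigD1 i) //= indicE mem_set // mule1.
  rewrite big1 ?adde0//.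
  move=> j ji; rewrite indicE memNset ?mule0// => Ejx.
  by rewrite (Einj _ _ _ Eix Ejx) eqxx in ji.
have intS : \int[P]_x S x = \sum_i (c i)%:E * P (E i).
  rewrite ge0_integral_sum //; apply: eq_bigr => i _.
  rewrite ge0_integralZl_EFin ?lee_fin //; last first.
    exact/measurable_EFinP/measurable_indic.
  by rewrite integral_indic ?setIT.
(* Squeeze [X] between the measurable functions [S] and [S] plus infinity times the indicator of the
   complement of [D]. As that complement is null, both bounds have the same integral. *)
rewrite unlock -intS; apply/eqP; rewrite eq_le; apply/andP; split; last first.
  apply: ge0_le_integral_nonmeasurable => // x.
  have [[i _ Eix]|Dx] := pselect (D x).
    by rewrite (SE _ _ Eix) (XE _ _ Eix).
  rewrite /S /term big1 ?lee_fin // => i _.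
  rewrite indicE memNset ?mule0 // => Eix.
  by apply: Dx; exists i.
have mS : measurable_fun setT S by exact: emeasurable_sum.
have mN : measurable_fun setT (EFin \o \1_(~` D) : T -> \bar R).
  exact/measurable_EFinP/measurable_indic/measurableC.
have intN : \int[P]_x (+oo * (\1_(~` D) x)%:E) = 0.
  rewrite ge0_integralZl //.
  rewrite integral_indic ?setIT //; last exact: measurableC.
  by rewrite [X in _ * X]PD mule0.
rewrite -[leRHS]adde0 -intN -ge0_integralD //; last exact: measurable_funeM.
apply: ge0_le_integral_nonmeasurable => x; first by rewrite lee_fin.
have [Dx|Dx] := pselect (D x).
  case: (Dx) => i _ Eix; rewrite (SE _ _ Eix) (XE _ _ Eix).
  by rewrite indicE memNset ?mule0 ?adde0 // => /(_ Dx).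
rewrite [in leRHS]indicE mem_set // mule1 addey ?leey // gt_eqF //.
by rewrite (lt_le_trans _ (S0 x)).
Qed.

End Expectation.

(** * From neutral priors to uniform rankings *)

Section NeutralPriors.
Context {R : realType} {n m : nat}.
Local Open Scope classical_set_scope.

(** Positivity is added to the order event of [neutral] so that [positive_ranking] is the whole
    permutation. *)
Definition ranked (s : 'S_m) : set (valuation R m) :=
  [set v | (forall j, 0 < tnth v j) /\
    forall k l : 'I_m, (k < l)%N -> tnth v (s l) < tnth v (s k)].

Let measurable_item (j : 'I_m) :
  measurable_fun setT (fun v : valuation R m => tnth v j).
Proof. exact: measurable_tnth. Qed.

Let measurable_item_lt (j k : 'I_m) :
  measurable [set v : valuation R m | tnth v j < tnth v k].
Proof.
have mf := measurable_fun_ltr (measurable_item j) (measurable_item k).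
by have := mf measurableT [set true] I; rewrite setTI.
Qed.

Let measurable_item_gt0 (j : 'I_m) :
  measurable [set v : valuation R m | 0 < tnth v j].
Proof.
have mf := measurable_fun_ltr (@measurable_cst _ _ _ _ setT (0 : R))
  (measurable_item j).
by have := mf measurableT [set true] I; rewrite setTI.
Qed.

Let measurable_item_eq (j : 'I_m) (a : R) :
  measurable [set v : valuation R m | tnth v j = a].
Proof.
by have := measurable_item j measurableT (measurable_set1 a); rewrite setTI.
Qed.

Let measurable_positive :
  measurable [set v : valuation R m | forall j, 0 < tnth v j].
Proof.
rewrite [X in measurable X](_ : _ =
    \bigcap_(j in [set: 'I_m]) [set v : valuation R m | 0 < tnth v j]).
  exact: fin_bigcap_measurable.
by apply/seteqP; split=> v /= h j *; exact: h.
Qed.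

Let measurable_nonneg : measurable [set v : valuation R m | nonneg_valuation v].
Proof.
rewrite [X in measurable X](_ : _ =
    \bigcap_(j in [set: 'I_m]) ([set v : valuation R m | 0 < tnth v j] `|`
                                [set v : valuation R m | tnth v j = 0])).
  by apply: fin_bigcap_measurable => // j _; exact: measurableU.
apply/seteqP; split=> v /= h j => [_|].
  by have := h j; rewrite le_eqVlt => /predU1P[->|]; [right|left].
by case: (h j I) => [/ltW|/= ->].
Qed.

Let measurable_order (s : 'S_m) :
  measurable [set v : valuation R m |
    forall k l : 'I_m, (k < l)%N -> tnth v (s l) < tnth v (s k)].
Proof.
rewrite [X in measurable X](_ : _ =
    \bigcap_(p in [set p : 'I_m * 'I_m | (p.1 < p.2)%N])
      [set v : valuation R m | tnth v (s p.2) < tnth v (s p.1)]).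
  by apply: fin_bigcap_measurable => //; exact: finite_finset.
apply/seteqP; split=> v /= h; first by move=> [k l] /= kl; exact: h.
by move=> k l kl; exact: (h (k, l)).
Qed.

Lemma measurable_ranked (s : 'S_m) : measurable (ranked s).
Proof. exact: measurableI measurable_positive (measurable_order s). Qed.

(** Values are almost surely nonnegative and have no point mass at zero, hence are almost surely
    positive; intersecting the order event with positivity keeps its probability. *)
Lemma neutral_ranked (D : probability (valuation R m) R) (s : 'S_m) :
  neutral D -> D (ranked s) = (m`!%:R^-1)%:E.
Proof.
case=> [D_nonneg D_order D_atomless].
have positive_ae : {ae D, forall v, forall j, 0 < tnth v j}.
  have nonneg_ae : {ae D, forall v : valuation R m, nonneg_valuation v}.
    apply/negligibleP; first exact: measurableC.
    apply: etrans (probability_setC D measurable_nonneg) _.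
    by rewrite D_nonneg subee.
  have neq0_ae : {ae D, forall v : valuation R m, forall j, tnth v j <> 0}.
    apply: filter_forall => j; apply/negligibleP.
      exact: measurableC (measurableC (measurable_item_eq j 0)).
    by apply: etrans (D_atomless j 0); congr (D _); exact: setCK.
  apply: filterS2 nonneg_ae neq0_ae => v v_ge0 v_neq0 j.
  by rewrite lt_neqAle v_ge0 eq_sym andbT; apply/eqP.
have mA := measurable_order s.
rewrite -(D_order s) [RHS](measureDI D mA measurable_positive).
rewrite [X in (X + _)%E](@subset_measure0 _ _ _ D _
    (~` [set v : valuation R m | forall j, 0 < tnth v j])).
- by rewrite add0e setIC.
- exact: measurableD.
- exact: measurableC.
- by move=> v [].
- by apply: measure_negligible => //; exact: measurableC.
Qed.

Lemma ranked_positive_ranking (s : 'S_m) v : ranked s v ->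
  positive_ranking v = map s (enum 'I_m).
Proof.
move=> [v_gt0 /ranking_perm <-]; apply/all_filterP/allP => j _.
by rewrite inE v_gt0.
Qed.

Lemma ranked_inj (s s' : 'S_m) v : ranked s v -> ranked s' v -> s = s'.
Proof.
move=> /ranked_positive_ranking h /ranked_positive_ranking; rewrite h.
by move=> /eq_in_map ss'; apply/permP => k; rewrite ss' ?mem_enum.
Qed.

(** The ranking profiles of the other agents cut the space into events that are equally likely by
    independence, and on each of them the utility of [i] is constant. *)
Lemma round_robin_pass_expectation (D : 'I_n -> probability (valuation R m) R)
    (leftover : profile R n m -> allocation n m) (i : 'I_n)
    (v r : valuation R m) :
  (forall k, neutral (D k)) -> (1 < n)%N -> nonneg_valuation v ->
  ('E_(others_prior D i)
     [fun w => utility v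
        (bundle (round_robin_pass leftover (with_report i r w)) i)] =
   (gain i (turns n m) v (positive_ranking r) * m`!%:R^-1 ^+ n.-1)%:E)%E.
Proof.
move=> D_neutral n_gt1 v_ge0.
pose E (s : {ffun 'I_n.-1 -> 'S_m}) : set (profile R n.-1 m) :=
  [set w | forall j, ranked (s j) (tnth w j)].
pose c s := \sum_(k | wins i (turns n m) (positive_ranking r) s k) tnth v k.
have PE s : (others_prior D i (E s) = (m`!%:R^-1 ^+ n.-1)%:E)%E.
  have mranked j : measurable (ranked (s j)) by exact: measurable_ranked.
  apply: etrans (product_probabilityE (fun j => D (lift i j)) mranked) _.
  under eq_bigr do rewrite neutral_ranked //.
  by rewrite prodEFin prodr_const card_ord.
rewrite (@expectation_partition _ _ _ _ _ E c).
- under eq_bigr do rewrite PE.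
  by rewrite sumEFin -mulr_suml.
- move=> s; rewrite [X in measurable X](_ : _ =
    \bigcap_(j in [set: 'I_n.-1])
      ((fun w : profile R n.-1 m => tnth w j) @^-1` ranked (s j))).
    apply: fin_bigcap_measurable => // j _; rewrite -[X in measurable X]setTI.
    by apply: measurable_tnth => //; exact: measurable_ranked.
  by apply/seteqP; split=> w /= h j *; exact: h.
- by move=> s s' w Ew Ew'; apply/ffunP => j; exact: ranked_inj (Ew j) (Ew' j).
- under eq_bigr do rewrite PE.
  rewrite sumEFin sumr_const card_ffun card_ord card_Sn.
  rewrite -[_ *+ (_ ^ _)]mulr_natr natrX.
  by rewrite -exprMn mulVf ?expr1n // pnatr_eq0 -lt0n fact_gt0.
- by move=> s; exact: sumr_ge0.
- by move=> w; exact: sumr_ge0.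
move=> s w Ew; set b := with_report i r w.
have listsE : positive_rankings b =1 report_lists i (positive_ranking r) s.
  move=> k; rewrite /positive_rankings /report_lists tnth_mktuple.
  by case: unlift => // j; exact/ranked_positive_ranking/Ew.
(* As [n] exceeds 1 there is another agent; she values every item positively on this event, so
   nothing reaches [leftover]. *)
have owned k : rr_final b k <> None.
  have j : 'I_n.-1 by apply: (@Ordinal _ 0); rewrite -ltnS prednK // ltnW.
  move=> /(rr_final_stops (lift i j)); rewrite tnth_mktuple liftK leNgt.
  by have [-> _] := Ew j.
rewrite /utility /c; apply: eq_bigl => k.
rewrite inE ffunE /wins -(eq_picks _ _ listsE) -rr_finalE.
by have := owned k; case: (rr_final b k).
Qed.

End NeutralPriors.

Theorem theorem4 (R : realType) (n m : nat)
    (leftover : profile R n m -> allocation n m) :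
  (forall D : 'I_n -> probability (valuation R m) R,
      (forall i : 'I_n, neutral (D i)) ->
      BIC D (round_robin_pass leftover)) /\
  (forall b : profile R n m,
      (forall i : 'I_n, nonneg_valuation (tnth b i)) ->
      sdp_efficient b (round_robin_pass leftover b) /\
      EF1 b (round_robin_pass leftover b)).
Proof.
split=> [D D_neutral i v b v_ge0 _|b b_ge0]; last first.
  by split; [exact: round_robin_pass_sdp_efficient|exact: round_robin_pass_EF1].
have [n_gt1|n_le1] := ltnP 1 n.
  rewrite !round_robin_pass_expectation // lee_fin.
  by rewrite ler_wpM2r ?exprn_ge0 ?invr_ge0 // gain_truthful.
(* Here [i] is the only agent, so she owns every item whatever she reports and the two expectations
   are equal. *)
have ord_eq0 (k : 'I_n) : k = 0%N :> nat.
  by apply/eqP; rewrite -leqn0 -ltnS (leq_trans (ltn_ord k)).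
have all_i (k : 'I_n) : k = i by apply: val_inj; rewrite /= !ord_eq0.
rewrite le_eqVlt; apply/orP/or_introl/eqP.
congr (expectation _ _); apply/funext => w.
by congr (utility v _); apply/setP => k; rewrite !inE !(all_i (_ k)).
Qed.
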